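(* Let $c\in\mathbb R$ with $c\ne0$, let $r\in C^1[0,\infty)$ and $u\in C[0,\infty)$ be real-valued with $\dot r(t)=-2c\,u(t)$, and let $k>0$. For $t>0$ define $U_t:\ell^2(\mathbb Z)\to\ell^2(\mathbb Z)$ by $$[U_te_n](m)=J_{m-n}\Big(\frac{k\,r(t)}{c}\Big),\qquad m,n\in\mathbb Z.$$ Then $U_t$ is unitary and $U_t\circ\pi_k(L(t))\circ U_t^*=M(2cm)$, where $M(2cm)$ is multiplication by the function $m\mapsto2cm$.
   Context: The Lie algebra considered ($\mathfrak e(2)$) has basis $H,E,F$ with $[E,F]=0$, $[H,E]=2E$, $[H,F]=-2F$ and $*$-structure $E^*=F$, $H^*=H$. The Lax operator is $L(t)=cH+r(t)(E+F)$ (with partner $M(t)=u(t)(E-F)$; the equation $\dot r=-2cu$ is $\dot L=[M,L]$). The representation $\pi_k$, $k>0$, on $\ell^2(\mathbb Z)$ with standard orthonormal basis $\{e_n\}_{n\in\mathbb Z}$ is $\pi_k(H)e_n=2n\,e_n$, $\pi_k(E)e_n=k\,e_{n+1}$, $\pi_k(F)e_n=k\,e_{n-1}$. Hence $\pi_k(L(t))e_n=kr(t)e_{n+1}+2cn\,e_n+kr(t)e_{n-1}$. This operator is densely defined, with domain $\mathcal D$ the finite linear combinations of the $e_n$; the operator identity in the claim is understood on $U_t(\mathcal D)$. $J_n$ ($n\in\mathbb Z$) is the Bessel function of the first kind, $J_n(z)=\frac{z^n}{2^n\Gamma(n+1)}\,{}_0F_1(-;n+1;-z^2/4)$ (interpreted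 by continuity for negative integers $n$, so $J_{-n}=(-1)^nJ_n$). *)

(* Defs.v *)
From HB Require Import structures.
From mathcomp Require Import all_boot all_order all_algebra.
From mathcomp Require Import complex ring lra.
From mathcomp Require Import all_classical all_reals all_analysis.

Set Implicit Arguments.
Unset Strict Implicit.
Unset Printing Implicit Defensive.

Import Order.TTheory GRing.Theory Num.Theory.
Import numFieldNormedType.Exports ComplexField.Normc.

Local Open Scope classical_set_scope.
Local Open Scope complex_scope.
Local Open Scope ring_scope.

Section Bessel.
Context {R : realType}.

Definition pochhammer (a : R) (j : nat) : R := \prod_(i < j) (a + i%:R).

Definition hyp0F1 (b z : R) : R :=
  limn (series (fun j => z ^+ j / (pochhammer b j * j`!%:R))).

(* For n : nat, Gamma(n+1) = n!. *)
Definition besselJ_nat (n : nat) (z : R) : R :=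
  z ^+ n / (2 ^+ n * n`!%:R) * hyp0F1 n.+1%:R (- z ^+ 2 / 4).

(* The formula for J_n is singular at negative integers n; its continuous
   extension in the order n is (-1)^n J_{-n}. Recall Negz n = - n.+1. *)
Definition besselJ (n : int) (z : R) : R :=
  match n with
  | Posz n => besselJ_nat n z
  | Negz n => (-1) ^+ n.+1 * besselJ_nat n.+1 z
  end.

(* r is C^1 on [0, +oo[ with derivative dr, one-sided at 0. *)
Definition C1_halfline (r dr : R -> R) : Prop :=
  (forall t, 0 <= t ->
     (fun s => (r s - r t) / (s - t)) @ within `[0, +oo[ t^' --> dr t) /\
  {within `[0, +oo[, continuous dr}.

End Bessel.

Section l2.
Context {R : realType}.

Definition l2sum (f : int -> R[i]) : \bar R :=
  (\esum_(m in [set: int]) (normc (f m) ^+ 2)%:E)%E.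

Definition l2pred : {pred int -> R[i]} := fun f => `[< (l2sum f < +oo)%E >].

Lemma normc_ge0 (x : R[i]) : 0 <= normc x.
Proof. by case: x => a b; exact: sqrtr_ge0. Qed.

Lemma normcD2 (x y : R[i]) :
  normc (x + y) ^+ 2 <= 2 * normc x ^+ 2 + 2 * normc y ^+ 2.
Proof.
apply: (@le_trans _ _ ((normc x + normc y) ^+ 2)).
  by rewrite ler_sqr ?nnegrE ?addr_ge0 ?normc_ge0 ?le_normcD.
have := sqr_ge0 (normc x - normc y); lra.
Qed.

Lemma le_esumZ (k : R) (a : int -> R) : 0 <= k -> (forall m, 0 <= a m) ->
  (\esum_(m in [set: int]) (k * a m)%:E <=
   k%:E * \esum_(m in [set: int]) (a m)%:E)%E.
Proof.
move=> k0 a0; apply: ge_ereal_sup => _ [F FT <-].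
under eq_fsbigr do rewrite EFinM.
rewrite -ge0_mule_fsumr; last by move=> m; rewrite lee_fin.
rewrite lee_wpmul2l ?lee_fin//.
by apply: ereal_sup_ubound; exists F.
Qed.

Lemma l2_submod_closed : submod_closed l2pred.
Proof.
split.
  rewrite unfold_in; apply/asboolP.
  rewrite /l2sum esum1 ?ltry// => m _.
  by rewrite [X in normc X](_ : _ = 0)// normc0 expr0n.
move=> a f g; rewrite !unfold_in => /asboolP hf /asboolP hg; apply/asboolP.
apply: (@le_lt_trans _ _
  ((2 * normc a ^+ 2)%:E * l2sum f + 2%:E * l2sum g)%E); last first.
  apply: lte_add_pinfty; apply: lte_mul_pinfty => //.
  by rewrite lee_fin; apply: mulr_ge0 => //; exact: sqr_ge0.
have sq0 (h : int -> R[i]) m : 0 <= normc (h m) ^+ 2 by exact: sqr_ge0.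
have a20 : 0 <= 2 * normc a ^+ 2 by apply: mulr_ge0 => //; exact: sqr_ge0.
have two0 : 0 <= 2 :> R by [].
apply: le_trans (leeD (le_esumZ a20 (sq0 f)) (le_esumZ two0 (sq0 g))).
rewrite -esumD; last 2 first.
- by move=> m _; rewrite lee_fin; exact: mulr_ge0.
- by move=> m _; rewrite lee_fin; apply: mulr_ge0 => //; exact: sq0.
apply: le_esum => m _; rewrite -EFinD lee_fin.
by rewrite (le_trans (normcD2 _ _))// normcM exprMn mulrA.
Qed.

HB.instance Definition _ := GRing.isSubmodClosed.Build _ _ l2pred
  l2_submod_closed.

Record l2 := L2 { l2fun :> int -> R[i]; l2P : l2fun \in l2pred }.

HB.instance Definition _ := [isSub for l2fun].
HB.instance Definition _ := [Choice of l2 by <:].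
HB.instance Definition _ := [SubChoice_isSubLmodule of l2 by <:].

Definition l2norm (f : l2) : R := Num.sqrt (fine (l2sum f)).

(* Sum of an absolutely summable family indexed by the integers. *)
Definition sumZ (F : int -> R) : R :=
  fine (\esum_(m in [set: int]) ((EFin \o F)^\+ m) -
        \esum_(m in [set: int]) ((EFin \o F)^\- m))%E.

Definition csumZ (F : int -> R[i]) : R[i] :=
  sumZ (fun m => complex.Re (F m)) +i* sumZ (fun m => complex.Im (F m)).

Definition l2dot (f g : l2) : R[i] := csumZ (fun m => f m * (g m)^*).

Lemma delta_l2 (n : int) :
  (fun m : int => (m == n)%:R : R[i]) \in l2pred.
Proof.
rewrite unfold_in; apply/asboolP; rewrite /l2sum.
have -> : [set: int] = [set n] `|` ~` [set n] by rewrite setUv.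
have -> : (\esum_(m in [set n] `|` ~` [set n])
    (normc ((m == n)%:R : R[i]) ^+ 2)%:E = 1%:E :> \bar R)%E; last exact: ltry.
rewrite (esumID [set n]); last by move=> m _; rewrite lee_fin sqr_ge0.
rewrite (_ : (_ `&` [set n]) = [set n]); last by rewrite setUv setTI.
rewrite esum_set1 ?lee_fin ?sqr_ge0// eqxx normc1 expr1n esum1 ?adde0//.
by move=> m [_ /= /eqP/negbTE ->]; rewrite normc0 expr0n.
Qed.

Definition e_ (n : int) : l2 := L2 (delta_l2 n).

Definition domD : set l2 :=
  [set f | exists (s : seq int) (a : int -> R[i]),
             f = \sum_(n <- s) a n *: e_ n].

Definition bounded_op (U : l2 -> l2) : Prop :=
  exists C : R, forall f, l2norm (U f) <= C * l2norm f.

(* U is unitary and Us is its adjoint. *)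
Definition unitary_op (U Us : l2 -> l2) : Prop :=
  [/\ forall f g, l2dot (U f) g = l2dot f (Us g),
      cancel U Us & cancel Us U].

(* Multiplication by phi; it need not preserve l2. *)
Definition mult_op (phi : int -> R[i]) (f : int -> R[i]) : int -> R[i] :=
  fun m => phi m * f m.

End l2.
Arguments l2 R : clear implicits.

Section representation.
Context {R : realType}.

(* Elements of the complexified e(2), as coordinates in the basis H, E, F. *)
Local Notation e2 := 'rV[R[i]]_3.

Definition e2H : e2 := delta_mx 0 0.
Definition e2E : e2 := delta_mx 0 1.
Definition e2F : e2 := delta_mx 0 2%:R.

Definition laxL (c : R) (r : R -> R) (t : R) : e2 :=
  c%:C *: e2H + (r t)%:C *: (e2E + e2F).

Definition pi_basis (k : R) (X : e2) (n : int) : l2 R :=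
  X 0 0 *: ((2 * n)%:~R *: e_ n) +
  X 0 1 *: (k%:C *: e_ (n + 1)) +
  X 0 2%:R *: (k%:C *: e_ (n - 1)).

(* Linear extension to domD; for f in domD the sum has finite support. *)
Definition pi_op (k : R) (X : e2) (f : l2 R) : l2 R :=
  \sum_(n \in [set: int]) (f n *: pi_basis k X n).

Lemma pi_opE (k : R) (X : e2) (n : int) : pi_op k X (e_ n) = pi_basis k X n.
Proof.
rewrite /pi_op -(fsbig_widen [set n] [set: int]) /=; last 2 first.
- by [].
- by move=> m [_ /= /eqP/negbTE ->]; rewrite scale0r.
by rewrite fsbig_set1 /= eqxx scale1r.
Qed.

Lemma pi_opL (k c : R) (r : R -> R) (t : R) (n : int) :
  pi_op k (laxL c r t) (e_ n) =
  (k * r t)%:C *: e_ (n + 1) + (2 * c * n%:~R)%:C *: e_ n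
    + (k * r t)%:C *: e_ (n - 1).
Proof.
rewrite pi_opE /pi_basis /laxL !mxE /=.
rewrite !(mulr0, mulr1, addr0, add0r) !scalerA -!rmorphM [k * _]mulrC.
rewrite [_ *: e_ n + _]addrC; congr (_ + _ *: _ + _).
rewrite intrM mulrA !rmorphM /= rmorph_int [c%:C * _]mulrC.
by rewrite [2%:C](rmorph_nat (real_complex R) 2).
Qed.

End representation.

(* Main.v *)
(** The relation [2 J_n' = J_{n-1} - J_{n+1}] turns the derivative in z of
    the sum of [J_{m-p}(z) J_{m-q}(z)] over -N <= m < N into boundary terms,
    which vanish as N grows, so the sum of [J_{m-p}(z) J_{m-q}(z)] over all m
    keeps its value [delta_{pq}] at z = 0.  Hence the matrix [J_{m-n}(z)]
    is an isometry on finite sequences and defines a bounded operator on l2;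
    since [J_n(-z) = J_{-n}(z)], the operator attached to -z is both its adjoint
    and its inverse.  With z = k r(t) / c, the recurrence
    [z (J_{n-1} + J_{n+1}) = 2 n J_n] is the diagonalization of [pi_k(L(t))]. *)

From HB Require Import structures.
Require Import Defs.
From mathcomp Require Import all_boot all_order all_algebra.
From mathcomp Require Import complex ring lra zify.
From mathcomp Require Import all_classical all_reals all_analysis.

Set Implicit Arguments.
Unset Strict Implicit.
Unset Printing Implicit Defensive.

Import Order.TTheory GRing.Theory Num.Theory.
Import numFieldNormedType.Exports ComplexField.Normc.

Local Open Scope classical_set_scope.
Local Open Scope complex_scope.
Local Open Scope ring_scope.

(** * The functions [J_n] *)

Section bessel_function.
Context {R : realType}.
Implicit Types (x z : R) (n j : nat).

(** * Pochhammer symbols and the entire series 0F1 *)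

Lemma pochhammer0 (a : R) : pochhammer a 0 = 1.
Proof. exact: big_ord0. Qed.

Lemma pochhammerS (a : R) j : pochhammer a j.+1 = a * pochhammer (a + 1) j.
Proof.
rewrite /pochhammer big_ord_recl addr0; congr (_ * _).
by apply: eq_bigr => i _; rewrite lift0 -natr1; ring.
Qed.

Lemma pochhammerSr (a : R) j :
  pochhammer a j.+1 = pochhammer a j * (a + j%:R).
Proof. by rewrite /pochhammer big_ord_recr. Qed.

Lemma pochhammer_ge1 (a : R) j : 1 <= a -> 1 <= pochhammer a j.
Proof.
elim: j a => [|j IH] a a1; first by rewrite pochhammer0.
by rewrite pochhammerS mulr_ege1// IH//; lra.
Qed.

Lemma pochhammer_gt0 n j : 0 < pochhammer (n.+1%:R : R) j.
Proof. by apply: lt_le_trans (pochhammer_ge1 _ _); rewrite ?ler1n. Qed.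

(** Taylor coefficients of 0F1(-; n+1; x), isolated so that [hyp0F1] becomes a [pseries], which can
    be differentiated termwise. *)
Definition hyp_coeff n j : R := (pochhammer n.+1%:R j * j`!%:R)^-1.

Lemma hyp0F1E n x : hyp0F1 n.+1%:R x = limn (pseries (hyp_coeff n) x).
Proof.
by rewrite /hyp0F1; congr (limn (series _)); apply/funext => j; rewrite mulrC.
Qed.

Lemma hyp_coeff_ge0 n j : 0 <= hyp_coeff n j.
Proof. by rewrite invr_ge0 mulr_ge0// ltW// pochhammer_gt0. Qed.

(** Since (n+1)_j >= 1, the series is dominated by the exponential one uniformly in n; convergence
    everywhere and the growth bound follow. *)
Lemma hyp_coeff_le n j : hyp_coeff n j <= j`!%:R^-1.
Proof.
have f0 : 0 < j`!%:R :> R by rewrite ltr0n fact_gt0.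
rewrite lef_pV2 ?posrE ?mulr_gt0 ?pochhammer_gt0//.
by rewrite ler_peMl ?(ltW f0)// pochhammer_ge1// ler1n.
Qed.

Lemma norm_hyp_term_le n x j :
  `|hyp_coeff n j * x ^+ j| <= exp_coeff `|x| j.
Proof.
rewrite normrM normrX ger0_norm ?hyp_coeff_ge0// /exp_coeff/= mulrC.
by rewrite ler_wpM2l ?exprn_ge0// hyp_coeff_le.
Qed.

Lemma is_cvg_normed_hyp n x :
  cvgn [normed series (fun j => hyp_coeff n j * x ^+ j)].
Proof.
apply: (@series_le_cvg _ _ (exp_coeff `|x|)) => [j|j|j|].
- exact: normr_ge0.
- exact: exp_coeff_ge0.
- exact: norm_hyp_term_le.
- exact: is_cvg_series_exp_coeff.
Qed.

Lemma is_cvg_hyp n x : cvgn (pseries (hyp_coeff n) x).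
Proof. exact/normed_cvg/is_cvg_normed_hyp. Qed.

Lemma norm_hyp0F1_le n x : `|hyp0F1 n.+1%:R x| <= expR `|x|.
Proof.
rewrite hyp0F1E.
apply: (le_trans (lim_series_norm (@is_cvg_normed_hyp n x))).
apply: lim_series_le (norm_hyp_term_le n x).
- exact: is_cvg_normed_hyp.
- exact: is_cvg_series_exp_coeff.
Qed.

(** From (n+1)_{j+1} = (n+1) (n+2)_j: differentiation raises the parameter by one and divides by the
    old one. *)
Lemma pseries_diffs_hyp n :
  pseries_diffs (hyp_coeff n) = n.+1%:R^-1 *: hyp_coeff n.+1.
Proof.
apply/funext => j; rewrite /pseries_diffs /hyp_coeff /GRing.scale/=.
rewrite pochhammerS natr1 factS natrM.
have P0 := pochhammer_gt0 n.+1 j.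
have F0 : 0 < j`!%:R :> R by rewrite ltr0n fact_gt0.
rewrite /GRing.scale/=; field.
by rewrite !nat1r !lt0r_neq0.
Qed.

Lemma pseries_diffsZ (a : R) (f : nat -> R) :
  pseries_diffs (a *: f) = a *: pseries_diffs f.
Proof. by apply/funext => j; rewrite /pseries_diffs /GRing.scale/= mulrCA. Qed.

Lemma pseriesZ (a : R) (f : nat -> R) x :
  pseries (a *: f) x = a *: pseries f x.
Proof.
rewrite /pseries -seriesZ; congr series; apply/funext => j.
exact/esym/mulrA.
Qed.

Lemma is_derive_hyp0F1 n x :
  is_derive x 1 (hyp0F1 n.+1%:R) (n.+1%:R^-1 * hyp0F1 n.+2%:R x).
Proof.
have -> : hyp0F1 n.+1%:R = fun y : R => limn (pseries (hyp_coeff n) y).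
  by apply/funext => y; exact: hyp0F1E.
have -> : n.+1%:R^-1 * hyp0F1 n.+2%:R x =
    limn (pseries (pseries_diffs (hyp_coeff n)) x).
  rewrite pseries_diffs_hyp pseriesZ hyp0F1E.
  by apply/esym/cvg_lim => //; apply: cvgZl_tmp; exact: is_cvg_hyp.
(* Termwise differentiation asks for convergence at some point beyond |x|; the series converges
   everywhere, so any such point serves. *)
apply: (@pseries_snd_diffs _ _ (`|x| + 1)).
- exact: is_cvg_hyp.
- rewrite pseries_diffs_hyp pseriesZ; by apply: is_cvgZl_tmp; exact: is_cvg_hyp.
- rewrite !(pseries_diffs_hyp, pseries_diffsZ, pseriesZ).
  by apply: is_cvgZl_tmp; apply: is_cvgZl_tmp; exact: is_cvg_hyp.
- by rewrite [ltRHS]ger0_norm ?addr_ge0// ltrDl.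
Qed.

(** Coefficientwise: the constant terms cancel, and the coefficient of x^(j+1) on the left is
    proportional to that of x^j in the last series. *)
Lemma hyp0F1_contiguous n x :
  hyp0F1 n.+1%:R x - hyp0F1 n.+2%:R x =
  x / (n.+1%:R * n.+2%:R) * hyp0F1 n.+3%:R x.
Proof.
rewrite !hyp0F1E.
set a := pseries (hyp_coeff n) x; set b := pseries (hyp_coeff n.+1) x.
set d := pseries (hyp_coeff n.+2) x.
have ca : cvgn a := @is_cvg_hyp n x.
have cb : cvgn b := @is_cvg_hyp n.+1 x.
have cd : cvgn d := @is_cvg_hyp n.+2 x.
(* One extra term on the left: after the constant terms cancel, N terms remain to match those of
   [d N]. *)
have cab : a N.+1 - b N.+1 @[N --> \oo] --> limn a - limn b.
  by apply: cvgB; rewrite cvg_shiftS.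
apply: (cvg_unique (@Rhausdorff R) cab).
have -> : (fun N => a N.+1 - b N.+1) =
    (fun N => x / (n.+1%:R * n.+2%:R) * d N); last first.
  by apply: cvgM => //; exact: cvg_cst.
apply/funext => N; rewrite /a /b /d /pseries /series/= !big_nat_recl//.
rewrite /hyp_coeff !pochhammer0 opprD addrACA subrr add0r.
rewrite -sumrB mulr_sumr; apply: eq_bigr => j _.
have -> : pochhammer n.+3%:R j =
    pochhammer n.+2%:R j * (n.+2%:R + j%:R) / n.+2%:R :> R.
  by rewrite -pochhammerSr pochhammerS natr1 mulrC mulKf// pnatr_eq0.
rewrite (pochhammerS n.+1%:R) pochhammerSr natr1 exprS factS natrM.
have P0 := pochhammer_gt0 n.+1 j.
have F0 : 0 < j`!%:R :> R by rewrite ltr0n fact_gt0.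
field.
by rewrite !lt0r_neq0.
Qed.

(** * Recurrence, derivative and decay of the Bessel functions *)

Lemma besselJ_natD2 n z : besselJ_nat n z + besselJ_nat n.+2 z =
  z ^+ n / (2 ^+ n * n`!%:R) * hyp0F1 n.+2%:R (- z ^+ 2 / 4).
Proof.
rewrite /besselJ_nat.
(* At x = -z^2/4 the last term of the contiguous relation, times the prefactor of J_n, is exactly
   -J_{n+2}. *)
have /(canRL (subrK _)) -> := hyp0F1_contiguous n (- z ^+ 2 / 4).
have F0 : n`!%:R != 0 :> R by rewrite pnatr_eq0 -lt0n fact_gt0.
have T0 : 2 ^+ n != 0 :> R by rewrite expf_neq0// pnatr_eq0.
rewrite !factS !exprS !natrM; field.
by rewrite F0 T0 !lt0r_neq0.
Qed.

Lemma besselJ_nat_rec n z :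
  z * (besselJ_nat n z + besselJ_nat n.+2 z) =
  2 * n.+1%:R * besselJ_nat n.+1 z.
Proof.
rewrite besselJ_natD2 /besselJ_nat.
have F0 : n`!%:R != 0 :> R by rewrite pnatr_eq0 -lt0n fact_gt0.
have T0 : 2 ^+ n != 0 :> R by rewrite expf_neq0// pnatr_eq0.
rewrite !factS !exprS !natrM; field.
by rewrite F0 T0 !lt0r_neq0.
Qed.

(** Product rule; differentiating the 0F1 factor gives -J_{n+1}. The power-rule term is left
    unsimplified so that n = 0 is covered, its factor n being zero there. *)
Lemma is_derive_besselJ_nat n z : is_derive z 1 (besselJ_nat n)
  (n%:R * z ^+ n.-1 / (2 ^+ n * n`!%:R) * hyp0F1 n.+1%:R (- z ^+ 2 / 4)
   - besselJ_nat n.+1 z).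
Proof.
have E : besselJ_nat n = ((2 ^+ n * n`!%:R)^-1 *: (id ^+ n : R -> R)) *
    (hyp0F1 n.+1%:R \o ((- 4^-1) *: (id ^+ 2 : R -> R))).
  apply/funext => y; rewrite /besselJ_nat /= mulrfctE/=.
  rewrite exprfctE /GRing.scale/=; congr (_ * _); first exact: mulrC.
  by congr (hyp0F1 _ _); rewrite exprfctE /GRing.scale/=; field.
have dh := is_derive_hyp0F1 n (((- 4^-1) *: (id ^+ 2 : R -> R)) z).
rewrite E; apply: is_derive_eq.
rewrite /besselJ_nat /= !exprfctE /GRing.scale/=.
rewrite /GRing.scale/=.
have -> : - 4^-1 * z ^+ 2 = - z ^+ 2 / 4 by field.
have F0 : n`!%:R != 0 :> R by rewrite pnatr_eq0 -lt0n fact_gt0.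
have T0 : 2 ^+ n != 0 :> R by rewrite expf_neq0// pnatr_eq0.
rewrite !factS !exprS !natrM; field.
by rewrite F0 T0 !lt0r_neq0.
Qed.

(** The power 2^n is dropped from the denominator and the series is bounded by exp(z^2/4) <=
    exp(z^2). What matters is the factor |z|^n/n!, which tends to 0 in n. *)
Lemma norm_besselJ_nat_le n z :
  `|besselJ_nat n z| <= exp_coeff `|z| n * expR (z ^+ 2).
Proof.
rewrite /besselJ_nat normrM ler_pM//.
  have F0 : 0 < n`!%:R :> R by rewrite ltr0n fact_gt0.
  rewrite normrM normfV normrX /exp_coeff/= ler_wpM2l ?exprn_ge0//.
  have T1 : 1 <= 2 ^+ n :> R by rewrite exprn_ege1// ler1n.
  rewrite ger0_norm ?mulr_ge0 ?(ltW F0) ?(le_trans ler01)//.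
  rewrite lef_pV2 ?posrE ?mulr_gt0//.
  by rewrite ler_peMl// ltW.
apply: (le_trans (norm_hyp0F1_le _ _)); rewrite ler_expR.
by have z0 := sqr_ge0 z; rewrite mulNr normrN ger0_norm//; lra.
Qed.

Lemma besselJ_natN n z : besselJ_nat n (- z) = (-1) ^+ n * besselJ_nat n z.
Proof. by rewrite /besselJ_nat sqrrN (exprNn z) !mulrA. Qed.

Lemma besselJN (m : int) z : besselJ (- m) z = (-1) ^+ `|m|%N * besselJ m z.
Proof.
case: m => [[|n]|n].
- by rewrite oppr0 expr0 mul1r.
- by rewrite -NegzE.
- by rewrite NegzE opprK abszN/= mulrA -exprMn mulrNN mulr1 expr1n mul1r.
Qed.

Lemma besselJ_opp (m : int) z : besselJ m (- z) = besselJ (- m) z.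
Proof.
rewrite besselJN; case: m => n /=; first exact: besselJ_natN.
by rewrite besselJ_natN.
Qed.

(** At m = 0 both sides vanish because J_{-1} = -J_1; negative orders are reflected to natural
    ones. *)
Lemma besselJ_rec (m : int) z :
  z * (besselJ (m - 1) z + besselJ (m + 1) z) = 2 * m%:~R * besselJ m z.
Proof.
case: m => [[|n]|n].
- have := besselJN 1 z; rewrite !(add0r, mulr0, mul0r) => ->.
  by rewrite expr1 mulN1r addNr mulr0.
- have -> : Posz n.+1 - 1 = n :> int by lia.
  have -> : Posz n.+1 + 1 = n.+2 :> int by lia.
  exact: besselJ_nat_rec.
have -> : Negz n - 1 = - n.+2%:Z :> int by lia.
have -> : Negz n + 1 = - n%:Z :> int by lia.
rewrite NegzE !besselJN/= rmorphN /=.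
have := besselJ_nat_rec n z.
rewrite !exprS; set s := _ ^+ n => H.
(* The minus sign of the order cancels one factor of (-1)^(n+1), leaving s = (-1)^n times the
   recurrence for natural orders. *)
rewrite [RHS](_ : _ = s * (2 * n.+1%:R * besselJ_nat n.+1 z)).
  by rewrite -H; ring.
by rewrite -pmulrn; ring.
Qed.

Lemma is_derive_besselJ (m : int) z : is_derive z 1 (besselJ m)
  ((besselJ (m - 1) z - besselJ (m + 1) z) / 2).
Proof.
have dnat n : is_derive z 1 (besselJ_nat n.+1)
    ((besselJ_nat n z - besselJ_nat n.+2 z) / 2).
  have d := is_derive_besselJ_nat n.+1 z.
  apply: is_derive_eq.
  (* The power-rule term is the mean of J_n and J_{n+2}; subtracting J_{n+2} leaves half their
     difference. *)
  have -> : n.+1%:R * z ^+ n.+1.-1 / (2 ^+ n.+1 * (n.+1)`!%:R) *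
      hyp0F1 n.+2%:R (- z ^+ 2 / 4) =
      (besselJ_nat n z + besselJ_nat n.+2 z) / 2.
    rewrite besselJ_natD2.
    have F0 : n`!%:R != 0 :> R by rewrite pnatr_eq0 -lt0n fact_gt0.
    have T0 : 2 ^+ n != 0 :> R by rewrite expf_neq0// pnatr_eq0.
    rewrite !factS !exprS !natrM/=; field.
    by rewrite F0 T0 !lt0r_neq0.
  by field.
case: m => [[|n]|n].
- have := besselJN 1 z; rewrite !add0r => ->.
  have d := is_derive_besselJ_nat 0 z.
  apply: is_derive_eq => /=.
  by rewrite !mul0r add0r; field.
- have -> : Posz n.+1 - 1 = n :> int by lia.
  have -> : Posz n.+1 + 1 = n.+2 :> int by lia.
  exact: dnat.
have -> : Negz n - 1 = - n.+2%:Z :> int by lia.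
have -> : Negz n + 1 = - n%:Z :> int by lia.
have d := dnat n.
have -> : besselJ (Negz n) = (-1) ^+ n.+1 *: (besselJ_nat n.+1 : R -> R).
  by [].
apply: is_derive_eq.
by rewrite !besselJN/= !exprS /GRing.scale/=; field.
Qed.

Lemma norm_besselJ_le (m : int) z :
  `|besselJ m z| <= exp_coeff `|z| `|m|%N * expR (z ^+ 2).
Proof.
case: m => n; first exact: norm_besselJ_nat_le.
rewrite /= normrM normrX normrN1 expr1n mul1r; exact: norm_besselJ_nat_le.
Qed.

Lemma besselJ0 (m : int) : besselJ m (0 : R) = (m == 0)%:R.
Proof.
case: m => [[|n]|n] /=; rewrite /besselJ_nat ?expr0n/= ?mul0r ?mulr0//.
rewrite mulr1 invr1 mul1r oppr0 mul0r hyp0F1E.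
rewrite mul1r; apply: cvg_lim => //.
(* The partial sum at N = 0 is empty; only from N = 1 on are the partial sums equal to 1. *)
rewrite -cvg_shiftS /=.
rewrite (_ : (fun N => _) = cst 1); first exact: cvg_cst.
apply/funext => N; rewrite /pseries /series/= big_nat_recl//.
rewrite /hyp_coeff pochhammer0 big1 => [|i _]; rewrite ?exprS ?mul0r ?mulr0//.
by rewrite fact0 expr0 !mulr1 invr1 addr0.
Qed.

End bessel_function.

(** * Sums over the integers *)

Section window_sum.
Context {V : zmodType}.
Implicit Types (F G : int -> V) (N : nat) (m : int).

(** Half-open, from -N to N-1: it reindexes over 2N naturals, and a telescoping sum leaves exactly
    the values at -N and N. *)
Definition window N : seq int := [seq i%:Z - N%:Z | i <- index_iota 0 N.*2].

Definition wsum F N := \sum_(m <- window N) F m.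

Lemma mem_window N m : (m \in window N) = (- N%:Z <= m < N%:Z).
Proof.
apply/mapP/idP => [[i +]|mN]; first by rewrite mem_index_iota => iN ->; lia.
exists (absz (m + N%:Z)); last by lia.
by rewrite mem_index_iota; lia.
Qed.

Lemma window_uniq N : uniq (window N).
Proof. by rewrite map_inj_uniq ?iota_uniq// => i j; lia. Qed.

Lemma wsumE F N : wsum F N = \sum_(0 <= i < N.*2) F (i%:Z - N%:Z).
Proof. by rewrite /wsum big_map. Qed.

Lemma wsumS F N : wsum F N.+1 = F (- N.+1%:Z) + wsum F N + F N.
Proof.
rewrite !wsumE doubleS big_nat_recr// big_nat_recl//=.
congr (F _ + _ + F _); rewrite ?add0r//; last by lia.
by apply: eq_bigr => i _; congr F; lia.
Qed.

Lemma wsum_telescope F N :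
  wsum (fun m => F m - F (m + 1)) N = F (- N%:Z) - F N.
Proof.
rewrite wsumE; pose f i := - F (i%:Z - N%:Z).
transitivity (\sum_(0 <= i < N.*2) (f i.+1 - f i)).
  apply: eq_bigr => i _; rewrite /f opprK addrC; congr (- F _ + _); lia.
by rewrite telescope_sumr// /f opprK addrC add0r; congr (_ - F _); lia.
Qed.

Lemma wsumD F G N : wsum (fun m => F m + G m) N = wsum F N + wsum G N.
Proof. exact: big_split. Qed.

Lemma eq_wsum F G N : F =1 G -> wsum F N = wsum G N.
Proof. by move=> FG; exact: eq_bigr. Qed.

Lemma wsum_single F N m : m \in window N ->
  (forall i, i != m -> F i = 0) -> wsum F N = F m.
Proof.
by move=> mN F0; rewrite /wsum (bigD1_seq m) ?window_uniq//= big1 ?addr0.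
Qed.

Lemma near_window m : \forall N \near \oo, m \in window N.
Proof. by exists `|m|.+1 => // N /= mN; rewrite mem_window; lia. Qed.

End window_sum.

(** * Window sums as approximations of unordered sums *)

Section sums_over_int.
Context {R : realType}.
Implicit Types (F G : int -> R) (N : nat) (m : int) (B : R).

Lemma ler_wsum F G N : (forall m, F m <= G m) -> wsum F N <= wsum G N.
Proof. by move=> FG; apply: ler_sum => m _. Qed.

Lemma norm_wsum_le F N : `|wsum F N| <= wsum (fun m => `|F m|) N.
Proof. exact: ler_norm_sum. Qed.

Lemma wsumZ (a : R) F N : wsum (fun m => a * F m) N = a * wsum F N.
Proof. by rewrite /wsum mulr_sumr. Qed.

Lemma nondecreasing_wsum F : (forall m, 0 <= F m) -> nondecreasing_seq (wsum F).
Proof.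
move=> F0; apply/nondecreasing_seqP => N; rewrite wsumS.
by rewrite -addrA addrCA lerDl addr_ge0.
Qed.

Lemma wsum_fsbig F N :
  (wsum F N)%:E = (\sum_(m \in [set` window N]) (F m)%:E)%E.
Proof. by rewrite /wsum -sumEFin fsbig_seq// window_uniq. Qed.

Lemma wsum_le_esum F N : (forall m, 0 <= F m) ->
  ((wsum F N)%:E <= \esum_(m in [set: int]) (F m)%:E)%E.
Proof.
move=> F0; apply: esum_ge; exists [set` window N].
  by split => //; exact: finite_seq.
by rewrite wsum_fsbig.
Qed.

(** Every finite set of integers lies in some window, so a bound on windows bounds the supremum over
    finite sets. *)
Lemma esum_le_wsum F B : (forall m, 0 <= F m) -> (forall N, wsum F N <= B) ->
  (\esum_(m in [set: int]) (F m)%:E <= B%:E)%E.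
Proof.
move=> F0 FB; apply: ge_ereal_sup => _ [A [finA _] <-].
have [N AN] : exists N, A `<=` [set` window N].
  move/finite_seqP : finA => [s ->].
  exists (\max_(m <- s) `|m|.+1)%N => m /= ms; rewrite mem_window.
  have /= := @leq_bigmax_seq _ s xpredT (fun m => `|m|.+1)%N m ms isT.
  set M := (\max_(_ <- _) _)%N. lia.
apply: (@le_trans _ _ (wsum F N)%:E); last by rewrite lee_fin.
rewrite wsum_fsbig; apply: lee_fsum_nneg_subset => //.
- exact: finite_seq.
- by move=> m /set_mem/AN mN; apply/mem_set.
- by move=> m _; rewrite lee_fin.
Qed.

Lemma esum_fin F B : (forall m, 0 <= F m) -> (forall N, wsum F N <= B) ->
  \esum_(m in [set: int]) (F m)%:E \is a fin_num.
Proof.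
move=> F0 FB; rewrite ge0_fin_numE; last first.
  by apply: esum_ge0 => m _; rewrite lee_fin.
by apply: le_lt_trans (esum_le_wsum F0 FB) _; rewrite ltry.
Qed.

(** Monotone convergence along windows; this turns the unordered sums in the definition of l2 into
    limits of sequences. *)
Lemma cvg_wsum_esum F B : (forall m, 0 <= F m) -> (forall N, wsum F N <= B) ->
  wsum F @ \oo --> fine (\esum_(m in [set: int]) (F m)%:E).
Proof.
move=> F0 FB; have ndF := nondecreasing_wsum F0.
have cF : cvgn (wsum F).
  by apply: nondecreasing_is_cvgn => //; exists B => _ [N _ <-].
suff -> : fine (\esum_(m in [set: int]) (F m)%:E) = limn (wsum F) by [].
apply/eqP; rewrite eq_le -!lee_fin fineK ?(esum_fin F0 FB)//.
rewrite (esum_le_wsum F0) => [|N]; last exact: nondecreasing_cvgn_le.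
rewrite -[leRHS]fineK ?(esum_fin F0 FB)// lee_fin; apply: limr_le => //.
near=> N; rewrite -lee_fin fineK ?(esum_fin F0 FB)//; exact: wsum_le_esum.
Unshelve. all: by end_near. Qed.

Lemma cvg_le_bound (u : nat -> R) (l B : R) :
  u @ \oo --> l -> (forall N, u N <= B) -> l <= B.
Proof.
move=> ul uB; rewrite -(cvg_lim _ ul)//; apply: limr_le; first exact: cvgP ul.
exact: nearW.
Qed.

(** * Absolutely summable and square-summable families *)

Definition absummable F := exists B, forall N, wsum (fun m => `|F m|) N <= B.

Lemma cvg_wsum F : absummable F -> wsum F @ \oo --> sumZ F.
Proof.
move=> [B FB].
(* Positive and negative parts match the two sums in [sumZ]; each is dominated by the absolute
   value. *)
pose p m := Num.max (F m) 0; pose q m := Num.max (- F m) 0.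
have p0 m : 0 <= p m by rewrite le_max lexx orbT.
have q0 m : 0 <= q m by rewrite le_max lexx orbT.
have pB N : wsum p N <= B.
  apply: le_trans (FB N); apply: ler_wsum => m.
  by rewrite ge_max ler_norm normr_ge0.
have qB N : wsum q N <= B.
  apply: le_trans (FB N); apply: ler_wsum => m.
  by rewrite ge_max -normrN ler_norm normr_ge0.
have -> : sumZ F = fine (\esum_(m in [set: int]) (p m)%:E) -
                   fine (\esum_(m in [set: int]) (q m)%:E).
  rewrite /sumZ -fineB ?(esum_fin p0 pB) ?(esum_fin q0 qB)//.
  congr (fine (_ - _))%E; apply: eq_esum => m _.
    by rewrite funeposE/= EFin_max.
  by rewrite funenegE/= EFin_max.
have -> : wsum F = (fun N => wsum p N - wsum q N).
  apply/funext => N; rewrite /wsum -sumrB; apply: eq_bigr => m _.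
  by rewrite /p /q; case: (leP 0 (F m)) => ?; case: (leP 0 (- F m)); lra.
by apply: cvgB; [exact: (cvg_wsum_esum p0 pB)|exact: (cvg_wsum_esum q0 qB)].
Qed.

Lemma sumZ_eq F (l : R) : absummable F -> wsum F @ \oo --> l -> sumZ F = l.
Proof.
by move=> /cvg_wsum cF cl; exact: (cvg_unique (@Rhausdorff R) cF cl).
Qed.

Lemma norm_sumZ_le F B : (forall N, wsum (fun m => `|F m|) N <= B) ->
  `|sumZ F| <= B.
Proof.
move=> FB; have /cvg_norm cF : wsum F @ \oo --> sumZ F.
  by apply: cvg_wsum; exists B.
apply: (cvg_le_bound cF) => N; exact: le_trans (norm_wsum_le F N) (FB N).
Qed.

Lemma absummableD F G : absummable F -> absummable G ->
  absummable (fun m => F m + G m).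
Proof.
move=> [A FA] [B GB]; exists (A + B) => N.
apply: le_trans (lerD (FA N) (GB N)); rewrite -wsumD.
by apply: ler_wsum => m; exact: ler_normD.
Qed.

Lemma absummableZ (a : R) F : absummable F -> absummable (fun m => a * F m).
Proof.
move=> [A FA]; exists (`|a| * A) => N.
rewrite (@eq_wsum _ _ (fun m => `|a| * `|F m|)) => [|m]; last exact: normrM.
by rewrite wsumZ ler_wpM2l.
Qed.

Lemma sumZD F G : absummable F -> absummable G ->
  sumZ (fun m => F m + G m) = sumZ F + sumZ G.
Proof.
move=> sF sG; apply: sumZ_eq; first exact: absummableD.
rewrite (_ : wsum _ = fun N => wsum F N + wsum G N); last first.
  by apply/funext => N; exact: wsumD.
by apply: cvgD; exact: cvg_wsum.
Qed.

Lemma sumZZ (a : R) F : absummable F -> sumZ (fun m => a * F m) = a * sumZ F.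
Proof.
move=> sF; apply: sumZ_eq; first exact: absummableZ.
rewrite (_ : wsum _ = fun N => a * wsum F N); last first.
  by apply/funext => N; exact: wsumZ.
by apply: cvgM; [exact: cvg_cst|exact: cvg_wsum].
Qed.

Lemma sumZ_single F m : (forall i, i != m -> F i = 0) -> sumZ F = F m.
Proof.
move=> F0; have cF : wsum F @ \oo --> F m.
  apply: cvg_near_cst; near=> N; apply: wsum_single => //.
  by near: N; exact: near_window.
apply: sumZ_eq => //; exists `|F m| => N.
have [mN|mN] := boolP (m \in window N).
  rewrite (wsum_single mN)// => i im; by rewrite F0 ?normr0.
rewrite /wsum big_seq big1// => i iN; rewrite F0 ?normr0//.
by apply: contraNneq mN => <-.
Unshelve. all: by end_near. Qed.

(** Square-summability with an explicit bound, so that norm estimates can be carried through the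
    transform. *)
Definition sqsum_le F B := forall N, wsum (fun m => F m ^+ 2) N <= B.

(** From |ab| <= a^2 + b^2, a crude substitute for Cauchy-Schwarz that suffices for summability. *)
Lemma wsum_normM_le F G A B : sqsum_le F A -> sqsum_le G B ->
  forall N, wsum (fun m => `|F m * G m|) N <= A + B.
Proof.
move=> FA GB N; apply: le_trans (lerD (FA N) (GB N)); rewrite -wsumD.
apply: ler_wsum => m; rewrite normrM -(real_normK (num_real (F m))).
rewrite -(real_normK (num_real (G m))).
have := sqr_ge0 (`|F m| - `|G m|).
have := mulr_ge0 (normr_ge0 (F m)) (normr_ge0 (G m)); lra.
Qed.

Lemma absummableM F G A B : sqsum_le F A -> sqsum_le G B ->
  absummable (fun m => F m * G m).
Proof. by move=> FA GB; exists (A + B); exact: wsum_normM_le. Qed.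

End sums_over_int.

(** * Orthogonality *)

Section bessel_orthogonality.
Context {R : realType}.
Implicit Types (z : R) (N : nat) (m p q : int).

Lemma is_derive_sum_seq (T : eqType) (s : seq T) (f : T -> R -> R)
    (df : T -> R) z :
  (forall i, is_derive z 1 (f i) (df i)) ->
  is_derive z 1 (fun y => \sum_(i <- s) f i y) (\sum_(i <- s) df i).
Proof.
move=> dfi; rewrite -fct_sumE.
elim: s => [|i s IH]; first by rewrite !big_nil; exact: is_derive_cst.
by rewrite !big_cons; exact: is_deriveD.
Qed.

Lemma cvg_seq_sum (T : Type) (s : seq T) (u : T -> nat -> R) (l : T -> R) :
  (forall i, u i @ \oo --> l i) ->
  \sum_(i <- s) u i N @[N --> \oo] --> \sum_(i <- s) l i.
Proof.
move=> ul; elim: s => [|i s IH].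
  rewrite big_nil; under eq_fun do rewrite big_nil; exact: cvg_cst.
rewrite big_cons; under eq_fun do rewrite big_cons; exact: cvgD.
Qed.

(** The mean value theorem between 0 and z for either sign of z; |y| <= |z| lets estimates uniform
    on that disc apply at y. *)
Lemma MVT0 (f df : R -> R) z : (forall y : R, is_derive y 1 f (df y)) ->
  exists2 y, `|y| <= `|z| & f z - f 0 = df y * z.
Proof.
move=> fdf.
have cf a b : {within `[a, b], continuous f}.
  apply: continuous_subspaceT => y; apply: differentiable_continuous.
  by apply/derivable1_diffP; case: (fdf y).
have [z0|z0] := leP 0 z.
  have [y + ->] := MVT_segment z0 (fun y _ => fdf y) (cf 0 z).
  rewrite in_itv/= => /andP[y0 yz]; exists y; last by rewrite subr0.
  by rewrite !ger0_norm.
have [y + E] := MVT_segment (ltW z0) (fun y _ => fdf y) (cf z 0).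
rewrite in_itv/= => /andP[zy y0]; exists y.
  by rewrite !ler0_norm ?(ltW z0)// lerN2.
by rewrite -opprB E sub0r mulrN opprK.
Qed.

Let prodJ p q z m := besselJ (m - p) z * besselJ (m - q) z.

(** Discrete antiderivative: the z-derivative of [prodJ p q z m] is half of
    [stepJ p q z m - stepJ p q z (m + 1)]. *)
Let stepJ p q z m := besselJ (m - 1 - p) z * besselJ (m - q) z +
                    besselJ (m - p) z * besselJ (m - 1 - q) z.

(* [J_n' = (J_{n-1} - J_{n+1}) / 2] makes the derivative telescope. *)
Lemma is_derive_wsum_besselJ p q N z :
  is_derive z 1 (fun y => wsum (prodJ p q y) N)
    ((stepJ p q z (- N%:Z) - stepJ p q z N) / 2).
Proof.
have -> : (stepJ p q z (- N%:Z) - stepJ p q z N) / 2 =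
    \sum_(m <- window N) (stepJ p q z m - stepJ p q z (m + 1)) / 2.
  by rewrite -mulr_suml -wsum_telescope.
apply: is_derive_sum_seq => m.
have d1 := is_derive_besselJ (m - p) z.
have d2 := is_derive_besselJ (m - q) z.
rewrite (_ : prodJ p q ^~ m = besselJ (m - p) * besselJ (m - q))//.
apply: is_derive_eq; rewrite /GRing.scale/= /stepJ addrK.
rewrite ![m - 1 - _]addrAC ![m + 1 - _]addrAC; by field.
Qed.

Lemma exp_coeff_le_expR (x : R) n : 0 <= x -> exp_coeff x n <= expR x.
Proof.
case: n => [|n] x0; first by rewrite /exp_coeff/= expr0 divr1 -expR0 ler_expR.
by apply: le_trans (expR_ge1Dxn n x0); rewrite lerDr.
Qed.

Lemma cvg_exp_coeff_int (x : R) (f : nat -> int) p :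
  (forall N, N <= `|f N| + `|p|)%N -> exp_coeff x `|f N|%N @[N --> \oo] --> 0.
Proof.
move=> fN.
apply: (cvg_comp (fun N => `|f N|%N) (exp_coeff x) _ (cvg_exp_coeff x)).
move=> A [K _ KA]; exists (K + `|p|)%N => // N /= KN; apply: KA => /=.
by have := fN N; lia.
Qed.

(** For each N the mean value theorem compares the window sums at z and at 0; the difference is
    controlled by the boundary terms at -N and N, which decay factorially. *)
Lemma wsum_besselJ_cvg z p q :
  wsum (prodJ p q z) @ \oo --> ((p == q)%:R : R).
Proof.
(* For |y| <= |z|, [C] bounds every J_m(y) and [b m] records the decay in m; a boundary product uses
   [C] for one factor and [b] for the other. *)
pose E := expR (z ^+ 2); pose C := expR `|z| * E.
pose b m := exp_coeff `|z| `|m|%N * E.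
have E0 : 0 <= E by exact: expR_ge0.
have C0 : 0 <= C by rewrite mulr_ge0 ?expR_ge0.
have Jb m y : `|y| <= `|z| -> `|besselJ m y| <= b m.
  move=> yz; apply: (le_trans (norm_besselJ_le m y)).
  rewrite ler_pM ?expR_ge0//.
  - exact: exp_coeff_ge0.
  - by rewrite /exp_coeff/= ler_wpM2r ?invr_ge0// lerXn2r ?nnegrE.
  - rewrite ler_expR -(real_normK (num_real y)) -(real_normK (num_real z)).
    by rewrite lerXn2r ?nnegrE.
have JC m y : `|y| <= `|z| -> `|besselJ m y| <= C.
  move=> yz; apply: (le_trans (Jb m y yz)).
  by rewrite ler_wpM2r// exp_coeff_le_expR.
have JJb i j y : `|y| <= `|z| -> `|besselJ i y * besselJ j y| <= C * b j.
  by move=> yz; rewrite normrM; apply: ler_pM => //; [exact: JC|exact: Jb].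
have stepb m y : `|y| <= `|z| ->
    `|stepJ p q y m| <= C * (b (m - q) + b (m - p)).
  move=> yz; apply: (le_trans (ler_normD _ _)); rewrite mulrDr.
  apply: lerD; first exact: JJb.
  by rewrite mulrC; exact: JJb.
(* Bounds for the two boundary terms, times |z|; the factor 1/2 of the derivative is given away. *)
pose eps N := C * (b (- N%:Z - q) + b (- N%:Z - p) +
  (b (N%:Z - q) + b (N%:Z - p))) * `|z|.
have bound N : `|wsum (prodJ p q z) N - wsum (prodJ p q 0) N| <= eps N.
  have [y yz ->] := MVT0 z (is_derive_wsum_besselJ p q N).
  rewrite normrM ler_wpM2r// mulrDr normrM normfV [`|2|]ger0_norm//.
  rewrite ler_pdivrMr//; apply: (le_trans (ler_normB _ _)).
  rewrite -[leLHS]mulr1 ler_pM ?addr_ge0 ?lerD ?stepb ?ler1n//.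
have eps0 : eps @ \oo --> (0 : R).
  have cb (f : nat -> int) r : (forall N, N <= `|f N| + `|r|)%N ->
      b (f N) @[N --> \oo] --> (0 : R).
    move=> fN; rewrite -(mul0r E); apply: cvgM; last exact: cvg_cst.
    exact: cvg_exp_coeff_int fN.
  rewrite (_ : 0 = C * (0 + 0 + (0 + 0)) * `|z|); last first.
    by rewrite !addr0 mulr0 mul0r.
  apply: cvgM; last exact: cvg_cst.
  apply: cvgM; first exact: cvg_cst.
  apply: cvgD; apply: cvgD.
  - by apply: (cb _ q) => N; lia.
  - by apply: (cb _ p) => N; lia.
  - by apply: (cb _ q) => N; lia.
  - by apply: (cb _ p) => N; lia.
have diff0 :
    wsum (prodJ p q z) N - wsum (prodJ p q 0) N @[N --> \oo] --> (0 : R).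
  apply/norm_cvg0P; apply: (squeeze_cvgr _ (cvg_cst 0) eps0).
  by apply: nearW => N; rewrite normr_ge0 bound.
(* At z = 0 the matrix is the identity, so the sum equals its limit as soon as p lies in the
   window. *)
have lim0 : wsum (prodJ p q 0) @ \oo --> ((p == q)%:R : R).
  apply: cvg_near_cst; near=> N.
  have pN : p \in window N by near: N; exact: near_window.
  rewrite (wsum_single pN) /prodJ => [|i ip]; rewrite !besselJ0 !subr_eq0.
    by rewrite eqxx mul1r.
  by rewrite (negbTE ip) mul0r.
rewrite (_ : wsum (prodJ p q z) = fun N =>
    (wsum (prodJ p q z) N - wsum (prodJ p q 0) N) + wsum (prodJ p q 0) N).
  by rewrite -[(p == q)%:R]add0r; exact: cvgD.
by apply/funext => N; rewrite subrK.
Unshelve. all: by end_near. Qed.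

Lemma wsum_besselJ_sq_le z p : sqsum_le (fun m => besselJ (m - p) z) 1.
Proof.
move=> N; have c : wsum (fun m => besselJ (m - p) z ^+ 2) @ \oo --> (1 : R).
  by have := @wsum_besselJ_cvg z p p; rewrite eqxx.
rewrite -(cvg_lim _ c)//; apply: nondecreasing_cvgn_le; last exact: cvgP c.
by apply: nondecreasing_wsum => m; exact: sqr_ge0.
Qed.

(** The matrix for -z is the transpose of the matrix for z, so facts about columns become facts
    about rows. *)
Lemma besselJ_flip z m n : besselJ (m - n) z = besselJ (n - m) (- z).
Proof. by rewrite besselJ_opp opprB. Qed.

Lemma wsum_besselJ_sq_le_row z m : sqsum_le (fun n => besselJ (m - n) z) 1.
Proof.
have := wsum_besselJ_sq_le (- z) m; congr sqsum_le.
by apply/funext => n; rewrite -besselJ_flip.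
Qed.

(** On a truncated f the transform is isometric: expand the square and let M grow, so that
    orthogonality of columns leaves the diagonal. Sums of squares increase in M and stay below the
    limit. *)
Lemma wsum_trunc_transform z (f : int -> R) N M :
  wsum (fun m => wsum (fun n => besselJ (m - n) z * f n) N ^+ 2) M <=
  wsum (fun n => f n ^+ 2) N.
Proof.
pose v m := wsum (fun n => besselJ (m - n) z * f n) N.
have c : wsum (fun m => v m ^+ 2) @ \oo --> wsum (fun n => f n ^+ 2) N.
  rewrite (_ : wsum _ = fun M => \sum_(p <- window N) \sum_(q <- window N)
      (f p * f q * wsum (prodJ p q z) M)); last first.
    apply/funext => L; rewrite /wsum.
    under [RHS]eq_bigr do under eq_bigr do rewrite mulr_sumr.
    under [RHS]eq_bigr do rewrite exchange_big/=.
    rewrite exchange_big/=; apply: eq_bigr => m _.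
    rewrite expr2 /v /wsum mulr_suml; apply: eq_bigr => p _.
    rewrite mulr_sumr; apply: eq_bigr => q _; rewrite /prodJ; ring.
  rewrite (_ : wsum _ N = \sum_(p <- window N) \sum_(q <- window N)
      (f p * f q * (p == q)%:R)); last first.
    rewrite [LHS]big_seq [RHS]big_seq; apply: eq_bigr => p pN.
    rewrite (bigD1_seq p) ?window_uniq//= eqxx mulr1 big1 ?addr0// => q.
    by rewrite eq_sym => /negbTE ->; rewrite mulr0.
  apply: cvg_seq_sum => p; apply: cvg_seq_sum => q.
  by apply: cvgM; [exact: cvg_cst|exact: wsum_besselJ_cvg].
rewrite -(cvg_lim _ c)//; apply: nondecreasing_cvgn_le; last exact: cvgP c.
by apply: nondecreasing_wsum => m; exact: sqr_ge0.
Qed.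

(* Fatou: each window sum is a limit over truncations of f. *)
Lemma sqsum_le_transform z (f : int -> R) B : sqsum_le f B ->
  sqsum_le (fun m => sumZ (fun n => besselJ (m - n) z * f n)) B.
Proof.
move=> fB M.
have c : wsum (fun m => wsum (fun n => besselJ (m - n) z * f n) N ^+ 2) M
    @[N --> \oo] -->
    wsum (fun m => sumZ (fun n => besselJ (m - n) z * f n) ^+ 2) M.
  apply: cvg_seq_sum => m; rewrite expr2.
  under eq_fun do rewrite expr2.
  by apply: cvgM; apply: cvg_wsum;
    exact: absummableM (wsum_besselJ_sq_le_row z m) fB.
apply: (cvg_le_bound c) => N.
exact: le_trans (wsum_trunc_transform z f N M) (fB N).
Qed.

End bessel_orthogonality.

(** * Density of finite sequences in l2 *)

Section l2_space.
Context {R : realType}.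
Implicit Types (f g : l2 R) (x y : R[i]).

(** * Complex coordinates and norm estimates in l2 *)

Lemma ReM x y : complex.Re (x * y) =
  complex.Re x * complex.Re y - complex.Im x * complex.Im y.
Proof. by case: x => a b; case: y. Qed.

Lemma ImM x y : complex.Im (x * y) =
  complex.Re x * complex.Im y + complex.Im x * complex.Re y.
Proof. by case: x => a b; case: y. Qed.

Lemma ReD x y : complex.Re (x + y) = complex.Re x + complex.Re y.
Proof. by case: x => a b; case: y. Qed.

Lemma ImD x y : complex.Im (x + y) = complex.Im x + complex.Im y.
Proof. by case: x => a b; case: y. Qed.

Lemma ReJ x : complex.Re x^* = complex.Re x.
Proof. by case: x. Qed.

Lemma ImJ x : complex.Im x^* = - complex.Im x.
Proof. by case: x. Qed.

Lemma complex_ext x y : complex.Re x = complex.Re y ->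
  complex.Im x = complex.Im y -> x = y.
Proof. by case: x => a b; case: y => c d /= -> ->. Qed.

Lemma normc_sq x : normc x ^+ 2 = complex.Re x ^+ 2 + complex.Im x ^+ 2.
Proof. by case: x => a b /=; rewrite sqr_sqrtr// addr_ge0// sqr_ge0. Qed.

Lemma normc_le_ReIm x : normc x <= `|complex.Re x| + `|complex.Im x|.
Proof.
have p0 : 0 <= `|complex.Re x| + `|complex.Im x| by rewrite addr_ge0.
rewrite -(ler_pXn2r (n := 2))// ?nnegrE ?normc_ge0// normc_sq sqrrD.
by rewrite !real_normK ?num_real//; have := mulr_ge0 (normr_ge0 (complex.Re x))
  (normr_ge0 (complex.Im x)); lra.
Qed.

Lemma l2DE f g m : (f + g) m = f m + g m.
Proof. by []. Qed.

Lemma l2ZE (a : R[i]) f m : (a *: f) m = a * f m.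
Proof. by []. Qed.

Lemma l2_sumE (T : Type) (s : seq T) (F : T -> l2 R) m :
  (\sum_(i <- s) F i) m = \sum_(i <- s) F i m.
Proof. by elim/big_ind2: _ => // u1 u2 v1 v2 <- <-. Qed.

Lemma l2_ext f g : f =1 g -> f = g.
Proof. by move=> fg; apply: val_inj; exact: funext. Qed.

Lemma l2sum_fin f : l2sum f \is a fin_num.
Proof.
rewrite ge0_fin_numE; first by have := l2P f; rewrite unfold_in => /asboolP.
by apply: esum_ge0 => m _; rewrite lee_fin sqr_ge0.
Qed.

Lemma l2norm_sq f : l2norm f ^+ 2 = fine (l2sum f).
Proof.
rewrite sqr_sqrtr// fine_ge0//; apply: esum_ge0 => m _.
by rewrite lee_fin sqr_ge0.
Qed.

Lemma wsum_normc_le f N : wsum (fun m => normc (f m) ^+ 2) N <= l2norm f ^+ 2.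
Proof.
rewrite l2norm_sq -lee_fin fineK ?l2sum_fin//.
by apply: wsum_le_esum => m; exact: sqr_ge0.
Qed.

Lemma l2norm_sq_le f B : (forall N, wsum (fun m => normc (f m) ^+ 2) N <= B) ->
  l2norm f ^+ 2 <= B.
Proof.
move=> fB; rewrite l2norm_sq -lee_fin fineK ?l2sum_fin//.
by apply: esum_le_wsum => // m; exact: sqr_ge0.
Qed.

Lemma mem_l2pred (F : int -> R[i]) B :
  (forall N, wsum (fun m => normc (F m) ^+ 2) N <= B) -> F \in l2pred.
Proof.
move=> FB; rewrite unfold_in; apply/asboolP.
apply: le_lt_trans (esum_le_wsum (B := B) _ FB) _; last exact: ltry.
by move=> m; exact: sqr_ge0.
Qed.

Lemma cvg_wsum_normc f :
  wsum (fun m => normc (f m) ^+ 2) @ \oo --> l2norm f ^+ 2.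
Proof.
rewrite l2norm_sq; apply: cvg_wsum_esum (wsum_normc_le f) => m.
exact: sqr_ge0.
Qed.

Lemma sqsum_le_Re f : sqsum_le (fun m => complex.Re (f m)) (l2norm f ^+ 2).
Proof.
move=> N; apply: le_trans (wsum_normc_le f N); apply: ler_wsum => m.
by rewrite normc_sq lerDl sqr_ge0.
Qed.

Lemma sqsum_le_Im f : sqsum_le (fun m => complex.Im (f m)) (l2norm f ^+ 2).
Proof.
move=> N; apply: le_trans (wsum_normc_le f N); apply: ler_wsum => m.
by rewrite normc_sq lerDr sqr_ge0.
Qed.

(** By a <= a^2 + 1, continuity of a coordinate takes the quadratic form in which functionals are
    tested in [scalar_eq0]. *)
Lemma normc_coord_le f m : normc (f m) <= l2norm f ^+ 2 + 1.
Proof.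
have : normc (f m) ^+ 2 <= l2norm f ^+ 2.
  rewrite -(cvg_lim _ (@cvg_wsum_normc f))//.
  apply: limr_ge; first exact: cvgP (@cvg_wsum_normc f).
  near=> N; have mN : m \in window N by near: N; exact: near_window.
  rewrite /wsum (bigD1_seq m) ?window_uniq//= lerDl.
  by apply: sumr_ge0 => i _; exact: sqr_ge0.
have := sqr_ge0 (normc (f m) - 1); have := normc_ge0 (f m); nra.
Unshelve. all: by end_near. Qed.

Lemma l2normZ_sq_le (a : R[i]) f :
  l2norm (a *: f) ^+ 2 <= normc a ^+ 2 * l2norm f ^+ 2.
Proof.
apply: l2norm_sq_le => N.
rewrite (@eq_wsum _ _ (fun m => normc a ^+ 2 * normc (f m) ^+ 2)) => [|m].
  by rewrite wsumZ ler_wpM2l ?sqr_ge0// wsum_normc_le.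
by rewrite l2ZE normcM exprMn.
Qed.

(** * Summability and linearity of the inner product *)

Lemma csumZD (F G : int -> R[i]) :
  absummable (fun m => complex.Re (F m)) ->
  absummable (fun m => complex.Im (F m)) ->
  absummable (fun m => complex.Re (G m)) ->
  absummable (fun m => complex.Im (G m)) ->
  csumZ (fun m => F m + G m) = csumZ F + csumZ G.
Proof.
move=> Fr Fi Gr Gi; rewrite /csumZ.
under [X in sumZ X +i* _]eq_fun do rewrite ReD.
under [X in _ +i* sumZ X]eq_fun do rewrite ImD.
by rewrite !sumZD.
Qed.

Lemma csumZZ (a : R[i]) (F : int -> R[i]) :
  absummable (fun m => complex.Re (F m)) ->
  absummable (fun m => complex.Im (F m)) ->
  csumZ (fun m => a * F m) = a * csumZ F.
Proof.
move=> Fr Fi; rewrite /csumZ; apply: complex_ext; rewrite ?ReM ?ImM/=.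
  rewrite -mulNr -!sumZZ// -sumZD; try exact: absummableZ.
  by congr sumZ; apply/funext => m; rewrite ReM mulNr.
rewrite -!sumZZ// -sumZD; try exact: absummableZ.
by congr sumZ; apply/funext => m; rewrite ImM.
Qed.

(** Serves both the real and the imaginary part of [f m * (g m)^*], each a combination of two
    products of square-summable real sequences. *)
Lemma wsum_norm_comb_le (a b c d e : int -> R) B :
  (forall m, `|a m| <= `|b m * c m| + `|d m * e m|) ->
  sqsum_le b B -> sqsum_le d B ->
  forall C, sqsum_le c C -> sqsum_le e C ->
  forall N, wsum (fun m => `|a m|) N <= (B + C) + (B + C).
Proof.
move=> abcde bB dB C cC eC N.
apply: le_trans (lerD (wsum_normM_le bB cC N) (wsum_normM_le dB eC N)).
by rewrite -wsumD; exact: ler_wsum.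
Qed.

Lemma wsum_dot_Re_le f g N :
  wsum (fun m => `|complex.Re (f m * (g m)^*)|) N <=
  (l2norm f ^+ 2 + l2norm g ^+ 2) + (l2norm f ^+ 2 + l2norm g ^+ 2).
Proof.
apply: (wsum_norm_comb_le _ (sqsum_le_Re f) (sqsum_le_Im f)
  (sqsum_le_Re g) (sqsum_le_Im g)) => m.
by rewrite ReM ReJ ImJ mulrN opprK ler_normD.
Qed.

Lemma wsum_dot_Im_le f g N :
  wsum (fun m => `|complex.Im (f m * (g m)^*)|) N <=
  (l2norm f ^+ 2 + l2norm g ^+ 2) + (l2norm f ^+ 2 + l2norm g ^+ 2).
Proof.
apply: (wsum_norm_comb_le _ (sqsum_le_Re f) (sqsum_le_Im f)
  (sqsum_le_Im g) (sqsum_le_Re g)) => m.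
by rewrite ImM ReJ ImJ mulrN (le_trans (ler_normD _ _))// normrN.
Qed.

Lemma normc_l2dot_le f g :
  normc (l2dot f g) <= 4 * (l2norm f ^+ 2 + l2norm g ^+ 2).
Proof.
apply: (le_trans (normc_le_ReIm _)) => /=.
have := norm_sumZ_le (wsum_dot_Re_le f g).
have := norm_sumZ_le (wsum_dot_Im_le f g); lra.
Qed.

Lemma l2dot_scalar g : scalar (fun f => l2dot f g).
Proof.
have sr f : absummable (fun m => complex.Re (f m * (g m)^*)).
  by eexists; exact: wsum_dot_Re_le.
have si f : absummable (fun m => complex.Im (f m * (g m)^*)).
  by eexists; exact: wsum_dot_Im_le.
move=> a f h; rewrite /l2dot -csumZZ// -csumZD//.
- by congr csumZ; apply/funext => m; rewrite l2DE l2ZE mulrDl mulrA.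
- have := sr (a *: f); congr absummable.
  by apply/funext => m; rewrite l2ZE mulrA.
- have := si (a *: f); congr absummable.
  by apply/funext => m; rewrite l2ZE mulrA.
Qed.

(** * Truncations, and functionals vanishing on the basis *)

Definition trunc f N : l2 R := \sum_(n <- window N) f n *: e_ n.

Lemma l2_combE (s : seq int) (a : int -> R[i]) m :
  (\sum_(n <- s) a n *: e_ n : l2 R) m = \sum_(n <- s) a n * (m == n)%:R.
Proof. by rewrite l2_sumE; apply: eq_bigr => n _; rewrite l2ZE. Qed.

Lemma truncE f N m : trunc f N m = if m \in window N then f m else 0.
Proof.
rewrite /trunc l2_combE; case: ifPn => mN.
  rewrite (bigD1_seq m) ?window_uniq//= eqxx mulr1 big1 ?addr0 // => i im.
  by rewrite eq_sym (negbTE im) mulr0.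
rewrite big_seq big1// => i iN.
by case: eqP => [mi|]; rewrite ?mulr0//; rewrite mi iN in mN.
Qed.

Lemma wsum_restrict (F : int -> R) N L : (N <= L)%N ->
  wsum (fun m => if m \in window N then F m else 0) L = wsum F N.
Proof.
move=> NL; rewrite /wsum -big_mkcond -big_filter; apply: perm_big.
apply: uniq_perm; rewrite ?filter_uniq ?window_uniq// => m.
rewrite mem_filter !mem_window; lia.
Qed.

Lemma l2norm_tail_le f N : l2norm (f - trunc f N) ^+ 2 <=
  l2norm f ^+ 2 - wsum (fun m => normc (f m) ^+ 2) N.
Proof.
apply: l2norm_sq_le => M; rewrite lerBrDr.
(* A window containing both, over which the tail and the truncated part are added term by term. *)
apply: le_trans (wsum_normc_le f (maxn M N)).
rewrite -(@wsum_restrict _ N (maxn M N)) ?leq_maxr//.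
apply: (@le_trans _ _ (wsum (fun m => normc ((f - trunc f N) m) ^+ 2) (maxn M N)
  + wsum (fun m => if m \in window N then normc (f m) ^+ 2 else 0) (maxn M N))).
  rewrite lerD2r; apply: nondecreasing_wsum (leq_maxl _ _) => m.
  exact: sqr_ge0.
rewrite -wsumD; apply: ler_wsum => m.
have -> : (f - trunc f N) m = f m - trunc f N m by [].
rewrite truncE; case: ifP => _; last by rewrite subr0 addr0.
by rewrite subrr normc0 expr0n add0r.
Qed.

(* Applying the quadratic bound to [l *: (f - trunc f N)] with l large makes
   [Phi f] smaller than any positive bound. *)
Lemma scalar_eq0 (Phi : l2 R -> R[i]) C : scalar Phi ->
  (forall f, normc (Phi f) <= C * (l2norm f ^+ 2 + 1)) ->
  (forall n, Phi (e_ n) = 0) -> forall f, Phi f = 0.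
Proof.
move=> linPhi PhiC Phie f.
have Phi0 : Phi 0 = 0.
  by have := linPhi (-1) 0 0; rewrite scaler0 addr0 mulN1r addNr.
have PhiZ a g : Phi (a *: g) = a * Phi g.
  by rewrite -[a *: g]addr0 linPhi Phi0 addr0.
have PhiD g h : Phi (g + h) = Phi g + Phi h.
  by rewrite -[g]scale1r linPhi mul1r scale1r.
have Phit N : Phi (trunc f N) = 0.
  rewrite /trunc; elim: (window N) => [|n s IH]; first by rewrite big_nil.
  by rewrite big_cons PhiD PhiZ Phie mulr0 add0r.
have C0 : 0 <= C.
  have := le_trans (normc_ge0 _) (PhiC 0).
  by rewrite pmulr_lge0// ltr_wpDl// sqr_ge0.
apply: eq0_normc; apply/eqP; rewrite eq_le normc_ge0 andbT leNgt.
(* With this [l], [l * x] is 2C + 1, whereas the bound at a vector of norm at most 1 allows only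
   2C. *)
apply/negP => x0; pose x := normc (Phi f); pose l := (2 * C + 1) / x.
have l0 : 0 < l by rewrite divr_gt0//; lra.
(* The tail scaled by [l] then has norm at most 1, and [Phi] takes the same value on the tail as on
   f. *)
have [N tailN] : exists N, l2norm (f - trunc f N) ^+ 2 <= l ^- 2.
  have l20 : 0 < l ^- 2 by rewrite invr_gt0 exprn_gt0.
  have /cvgrPdist_lt/(_ _ l20)[N _ /(_ N (leqnn N)) /= hN] :=
    @cvg_wsum_normc f.
  exists N; apply: (le_trans (l2norm_tail_le f N)).
  exact: le_trans (ler_norm _) (ltW hN).
have : l * x <= C * 2.
  have -> : l * x = normc (Phi (l%:C *: (f - trunc f N))).
    rewrite PhiZ PhiD -scaleN1r PhiZ Phit mulr0 addr0 normcM; congr (_ * _).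
    by rewrite /= expr0n addr0 sqrtr_sqr gtr0_norm.
  apply: (le_trans (PhiC _)); rewrite ler_wpM2l//.
  rewrite -[2]/(1 + 1) lerD2r; apply: (le_trans (l2normZ_sq_le _ _)).
  have -> : normc l%:C ^+ 2 = l ^+ 2 by rewrite normc_sq /= expr0n addr0.
  by rewrite -(divff (lt0r_neq0 (exprn_gt0 2 l0))) ler_wpM2l ?sqr_ge0.
by rewrite /l divfK ?lt0r_neq0//; lra.
Qed.

End l2_space.

(** * The operator with matrix [J_{m-n}(z)] *)

Section bessel_operator.
Context {R : realType}.
Implicit Types (f g : l2 R) (z : R) (m n : int).

(** The matrix is real, so it acts on real and imaginary parts separately and the real estimates
    apply to each. *)
Definition bessel_fun z f m : R[i] :=
  sumZ (fun n => besselJ (m - n) z * complex.Re (f n)) +i*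
  sumZ (fun n => besselJ (m - n) z * complex.Im (f n)).

(** The factor 2 appears because real and imaginary parts are each bounded by the full squared norm
    of f. *)
Lemma wsum_bessel_fun_le z f N :
  wsum (fun m => normc (bessel_fun z f m) ^+ 2) N <= 2 * l2norm f ^+ 2.
Proof.
rewrite (eq_wsum (G := fun m => complex.Re (bessel_fun z f m) ^+ 2 +
  complex.Im (bessel_fun z f m) ^+ 2)) => [|m]; last exact: normc_sq.
rewrite wsumD mulr_natl mulr2n; apply: lerD.
  exact: sqsum_le_transform (sqsum_le_Re f) _.
exact: sqsum_le_transform (sqsum_le_Im f) _.
Qed.

Definition bessel_op z f : l2 R := L2 (mem_l2pred (wsum_bessel_fun_le z f)).

Lemma Re_bessel_op z f m : complex.Re (bessel_op z f m) =
  sumZ (fun n => besselJ (m - n) z * complex.Re (f n)).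
Proof. by []. Qed.

Lemma Im_bessel_op z f m : complex.Im (bessel_op z f m) =
  sumZ (fun n => besselJ (m - n) z * complex.Im (f n)).
Proof. by []. Qed.

Lemma l2norm_bessel_op_le z f :
  l2norm (bessel_op z f) ^+ 2 <= 2 * l2norm f ^+ 2.
Proof. by apply: l2norm_sq_le => N; exact: wsum_bessel_fun_le. Qed.

Lemma bessel_op_bounded z : bounded_op (bessel_op z).
Proof.
exists 2 => f; rewrite -(ler_pXn2r (n := 2))// ?nnegrE ?mulr_ge0 ?sqrtr_ge0//.
apply: (le_trans (l2norm_bessel_op_le z f)).
by rewrite exprMn ler_wpM2r ?sqr_ge0// expr2; lra.
Qed.

Lemma bessel_op_linear z : linear (bessel_op z).
Proof.
have sr (h : l2 R) m :
    absummable (fun n => besselJ (m - n) z * complex.Re (h n)).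
  exact: absummableM (@wsum_besselJ_sq_le_row _ z m) (@sqsum_le_Re _ h).
have si (h : l2 R) m :
    absummable (fun n => besselJ (m - n) z * complex.Im (h n)).
  exact: absummableM (@wsum_besselJ_sq_le_row _ z m) (@sqsum_le_Im _ h).
move=> a f g; apply: l2_ext => m; rewrite l2DE l2ZE.
apply: complex_ext; rewrite ?ReD ?ImD ?ReM ?ImM/=.
  rewrite -mulNr -!sumZZ// -!sumZD//; try exact: absummableZ.
  - congr sumZ; apply/funext => n.
    by rewrite [X in complex.Re X](_ : _ = a * f n + g n)// ReD ReM; ring.
  - by apply: absummableD; exact: absummableZ.
rewrite -!sumZZ// -!sumZD//; try exact: absummableZ.
- congr sumZ; apply/funext => n.
  by rewrite [X in complex.Im X](_ : _ = a * f n + g n)// ImD ImM; ring.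
- by apply: absummableD; exact: absummableZ.
Qed.

HB.instance Definition _ z :=
  GRing.isLinear.Build R[i] (l2 R) (l2 R) _ (bessel_op z) (bessel_op_linear z).

Lemma e_E n m : (e_ n : l2 R) m = (m == n)%:R.
Proof. by []. Qed.

Lemma bessel_op_e z n m : bessel_op z (e_ n) m = (besselJ (m - n) z)%:C.
Proof.
apply: complex_ext => /=.
  rewrite (sumZ_single (m := n)) => [|i /negbTE ->]; last by rewrite mulr0.
  by rewrite eqxx mulr1.
rewrite (sumZ_single (m := n)) => [|i /negbTE ->]; last by rewrite mulr0.
by rewrite eqxx mulr0.
Qed.

Lemma Re_l2dot f g :
  complex.Re (l2dot f g) = sumZ (fun m => complex.Re (f m * (g m)^*)).
Proof. by []. Qed.

Lemma Im_l2dot f g :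
  complex.Im (l2dot f g) = sumZ (fun m => complex.Im (f m * (g m)^*)).
Proof. by []. Qed.

Lemma l2dot_e n g : l2dot (e_ n) g = (g n)^*.
Proof.
rewrite /l2dot /csumZ; apply: complex_ext; rewrite [LHS]/=.
  rewrite (sumZ_single (m := n)) => [|i /negbTE /= ->]; last by rewrite mul0r.
  by rewrite /= eqxx mul1r.
rewrite (sumZ_single (m := n)) => [|i /negbTE /= ->]; last by rewrite mul0r.
by rewrite /= eqxx mul1r.
Qed.

(** Each coordinate of the difference is a continuous functional of f, so it suffices to test basis
    vectors, where the claim is orthogonality of columns. *)
Lemma bessel_opK z : cancel (bessel_op z) (bessel_op (- z)).
Proof.
move=> f; apply: l2_ext => m; apply/eqP; rewrite -subr_eq0; apply/eqP.
pose Phi h := bessel_op (- z) (bessel_op z h) m - h m.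
(* Two applications of the operator cost a factor 4 in the squared norm, so 5 times the squared norm
   plus 2 bounds [Phi]; 10 is ample. *)
apply: (@scalar_eq0 _ Phi 10).
- move=> a h k; rewrite /Phi !bessel_op_linear !l2DE !l2ZE; ring.
- move=> h; apply: (le_trans (le_normcD _ _)); rewrite normcN.
  apply: (le_trans (lerD (normc_coord_le _ m) (normc_coord_le h m))).
  have := l2norm_bessel_op_le (- z) (bessel_op z h).
  have := l2norm_bessel_op_le z h; have := sqr_ge0 (l2norm h); lra.
move=> n; rewrite /Phi e_E; apply/eqP; rewrite subr_eq0; apply/eqP.
have E (F : int -> R) : F =1 (fun j => besselJ (j - m) z * besselJ (j - n) z) ->
    sumZ F = (m == n)%:R.
  move=> /funext ->; apply: sumZ_eq; last exact: wsum_besselJ_cvg.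
  by apply: absummableM; exact: wsum_besselJ_sq_le.
apply: complex_ext; rewrite ?Re_bessel_op ?Im_bessel_op.
  rewrite E => [|j]; last by rewrite bessel_op_e -besselJ_flip.
  by case: eqP.
rewrite (sumZ_single (m := m)) => [|j _]; rewrite bessel_op_e mulr0//.
by case: eqP.
Qed.

(** For fixed g the difference is a continuous functional of f; on basis vectors it vanishes by
    transposition. *)
Lemma bessel_op_adjoint z f g :
  l2dot (bessel_op z f) g = l2dot f (bessel_op (- z) g).
Proof.
apply/eqP; rewrite -subr_eq0; apply/eqP.
pose Phi h := l2dot (bessel_op z h) g - l2dot h (bessel_op (- z) g).
(* The two inner products are bounded by 12 times the sum of the squared norms of h and g, which the
   product form here dominates. *)
apply: (@scalar_eq0 _ Phi (12 * (l2norm g ^+ 2 + 1))).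
- by move=> a h k; rewrite /Phi bessel_op_linear !l2dot_scalar; ring.
- move=> h; apply: (le_trans (le_normcD _ _)); rewrite normcN.
  apply: (le_trans (lerD (normc_l2dot_le _ _) (normc_l2dot_le _ _))).
  have := l2norm_bessel_op_le (- z) g; have := l2norm_bessel_op_le z h.
  have := sqr_ge0 (l2norm h); have := sqr_ge0 (l2norm g).
  by have := mulr_ge0 (sqr_ge0 (l2norm h)) (sqr_ge0 (l2norm g)); lra.
move=> n; rewrite /Phi; apply/eqP; rewrite subr_eq0; apply/eqP.
rewrite l2dot_e.
apply: complex_ext.
  rewrite Re_l2dot ReJ Re_bessel_op; congr sumZ; apply/funext => m.
  by rewrite bessel_op_e ReM ReJ mul0r subr0 -besselJ_flip.
rewrite Im_l2dot ImJ Im_bessel_op -mulN1r -sumZZ; last first.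
  exact: absummableM (@wsum_besselJ_sq_le_row _ (- z) n) (@sqsum_le_Im _ g).
congr sumZ; apply/funext => m.
by rewrite bessel_op_e ImM ImJ mul0r addr0 -besselJ_flip mulrN mulN1r.
Qed.

(** Density of finite combinations; this gives the uniqueness of the operator with prescribed matrix
    entries. *)
Lemma bounded_linear_eq (U V : l2 R -> l2 R) : linear U -> linear V ->
  bounded_op U -> bounded_op V -> (forall n, U (e_ n) = V (e_ n)) -> U = V.
Proof.
move=> lU lV [C UC] [D VD] UV; apply/funext => f; apply: l2_ext => m.
apply/eqP; rewrite -subr_eq0; apply/eqP.
pose Phi h := U h m - V h m.
(* The operator bound has no known sign, but 0 <= a <= bc makes the product nonnegative, so squaring
   is safe. *)
have sq (a b c : R) : 0 <= a -> a <= b * c -> a ^+ 2 <= b ^+ 2 * c ^+ 2.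
  move=> a0 abc; rewrite -exprMn lerXn2r ?nnegrE//; exact: le_trans abc.
apply: (@scalar_eq0 _ Phi (C ^+ 2 + D ^+ 2 + 2)).
- by move=> a h k; rewrite /Phi lU lV !l2DE !l2ZE; ring.
- move=> h; apply: (le_trans (le_normcD _ _)); rewrite normcN.
  apply: (le_trans (lerD (normc_coord_le _ m) (normc_coord_le _ m))).
  have := sq _ _ _ (sqrtr_ge0 _) (UC h); have := sq _ _ _ (sqrtr_ge0 _) (VD h).
  have := sqr_ge0 (l2norm h); have := sqr_ge0 C; have := sqr_ge0 D.
  rewrite -/(l2norm _) -/(l2norm _); lra.
by move=> n; rewrite /Phi UV subrr.
Qed.

(** The list provided by [domD] may repeat indices; once duplicates are removed, the coefficients
    are the values of f itself. *)
Lemma domDE f : domD f ->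
  exists2 s : seq int, uniq s & f = \sum_(n <- s) f n *: e_ n.
Proof.
move=> [s [a fE]]; exists (undup s); first exact: undup_uniq.
apply: l2_ext => m; rewrite l2_combE.
have [ms|ms] := boolP (m \in undup s).
  rewrite (bigD1_seq m) ?undup_uniq//= eqxx mulr1 big1 ?addr0// => i im.
  by rewrite eq_sym (negbTE im) mulr0.
rewrite mem_undup in ms.
rewrite fE l2_combE !big_seq big1 => [|i si]; last first.
  by case: eqP => [mi|_]; rewrite ?mulr0//; rewrite mi si in ms.
rewrite big1// => i; rewrite mem_undup => si.
by case: eqP => [mi|_]; rewrite ?mulr0//; rewrite mi si in ms.
Qed.

(** Outside [s] the coordinates of f vanish, so the sum over all integers collapses to [s]. *)
Lemma pi_op_comb (k : R) X f (s : seq int) : uniq s ->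
  f = \sum_(n <- s) f n *: e_ n ->
  pi_op k X f = \sum_(n <- s) f n *: pi_basis k X n.
Proof.
move=> us fE; rewrite fsbig_seq// /pi_op; symmetry.
apply: fsbig_widen => // n [_ /= /negP ns].
rewrite fE l2_combE big_seq big1 ?scale0r// => i si.
by case: eqP => [ni|_]; rewrite ?mulr0//; rewrite ni si in ns.
Qed.

End bessel_operator.

(** * Diagonalization of the Lax operator *)

Theorem theorem6p1 (R : realType) (c k : R) (r dr u : R -> R)
    (c_neq0 : c != 0)
    (r_C1 : C1_halfline r dr)
    (u_cont : {within `[0, +oo[, continuous u})
    (dr_eq : forall t, 0 <= t -> dr t = - 2 * c * u t)
    (k_gt0 : 0 < k)
    (t : R) (t_gt0 : 0 < t) :
  exists U Ustar : l2 R -> l2 R,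
    [/\ unique (fun V : l2 R -> l2 R =>
          [/\ linear V, bounded_op V &
              forall m n : int,
                V (e_ n) m = (besselJ (m - n) (k * r t / c))%:C]) U,
        unitary_op U Ustar &
        forall f : l2 R, (U @` domD) f ->
          domD (Ustar f) /\
          l2fun (U (pi_op k (laxL c r t) (Ustar f))) =
            mult_op (fun m : int => (2 * c * m%:~R)%:C) f].
Proof.
set z := k * r t / c.
have cz : c * z = k * r t by rewrite /z mulrC divfK.
exists (bessel_op z), (bessel_op (- z)); split.
- split.
    split; [exact: bessel_op_linear|exact: bessel_op_bounded|].
    by move=> m n; exact: bessel_op_e.
  move=> V [lV bV Ve]; apply: bounded_linear_eq => //.
  + exact: bessel_op_linear.
  + exact: bessel_op_bounded.
  + by move=> n; apply: l2_ext => m; rewrite Ve bessel_op_e.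
- split.
  + by move=> f g; exact: bessel_op_adjoint.
  + exact: bessel_opK.
  + by have := @bessel_opK _ (- z); rewrite opprK.
(* The vector is the image of a finite combination g, and the adjoint, being the inverse, returns
   g. *)
move=> _ [g Dg <-]; rewrite bessel_opK; split => //.
have [s us gE] := domDE Dg.
rewrite (pi_op_comb _ _ us gE); apply/funext => m; rewrite /mult_op.
(* Both sides are linear in g, which reduces the identity to a single basis vector. *)
rewrite [in RHS]gE !linear_sum !l2_sumE mulr_sumr.
apply: eq_bigr => n _; rewrite !linearZ !l2ZE mulrCA; congr (_ * _).
rewrite -pi_opE pi_opL !linearD !linearZ !l2DE !l2ZE.
rewrite !bessel_op_e.
rewrite -!rmorphM -!rmorphD/=; congr (_%:C).
have := besselJ_rec (m - n) z; rewrite rmorphB/= => recJ.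
rewrite opprD addrA opprB addrA [m + 1 - n]addrAC -cz.
set A := besselJ (m - n - 1) z; set B := besselJ (m - n + 1) z.
(* The off-diagonal entries k r(t) = c z contribute 2 c (m - n) J_{m-n}(z) by the recurrence; the
   diagonal adds 2 c n J_{m-n}(z), for a total of 2 c m J_{m-n}(z). *)
transitivity (c * (z * (A + B)) + 2 * c * n%:~R * besselJ (m - n) z).
  by ring.
by rewrite recJ; ring.
Qed.
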